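(* Let $k\ge 1$ be an integer and $a>0$ a real number. Let $\lambda$ be a random variable with the gamma distribution $G(1/k,a)$, i.e. with density $$f(\lambda)=\frac{a^{1/k}}{\Gamma(1/k)}e^{-a\lambda}\lambda^{(1/k)-1},\qquad \lambda>0,$$ and let $\{X(t),t\ge0\}$ be a process which, conditionally on $\lambda$, is a Poisson process with rate $\lambda$. Put $Z(t)=kX(t)+1$. Then for every $t\ge 0$, $$E\{Z(t)\}=\frac{a+t}{a}\qquad\text{and}\qquad \mathrm{Var}\{Z(t)\}=\frac{(a+t)tk}{a^2}.$$
   Context: Conditionally on $\lambda$, $P(X(t)=n\mid\lambda)=e^{-\lambda t}(\lambda t)^n/n!$ for $n=0,1,2,\ldots$ *)

(* Defs.v *)
From HB Require Import structures.
From mathcomp Require Import all_boot all_order all_algebra.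
From mathcomp Require Import all_classical all_reals all_analysis.

Set Implicit Arguments.
Unset Strict Implicit.
Unset Printing Implicit Defensive.

Import Order.TTheory GRing.Theory Num.Theory.
Import numFieldNormedType.Exports.

Local Open Scope classical_set_scope.
Local Open Scope ring_scope.

(* Euler's integral; meant for 0 < s, where it converges. *)
Definition Gamma_fun {R : realType} (s : R) : R :=
  \int[lebesgue_measure]_(x in `]0, +oo[) (x `^ (s - 1) * expR (- x)).

Definition gamma_pdf {R : realType} (shape rate x : R) : R :=
  if 0 < x then
    rate `^ shape / Gamma_fun shape * expR (- (rate * x)) * x `^ (shape - 1)
  else 0.

Definition has_gamma_distribution {d : measure_display} {T : measurableType d}
    {R : realType} (P : probability T R) (L : {RV P >-> R})
    (shape rate : R) : Prop :=
  forall U : set R, measurable U ->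
    distribution P L U
      = (\int[lebesgue_measure]_(x in U) (gamma_pdf shape rate x)%:E)%E.

(* [g] is a version of the conditional probability of the event [A] given [L],
   i.e. P(A | L = l) = g l for almost every l under the law of [L]. *)
Definition is_cond_prob {d : measure_display} {T : measurableType d}
    {R : realType} (P : probability T R) (L : {RV P >-> R})
    (A : set T) (g : R -> R) : Prop :=
  measurable_fun [set: R] g /\
  forall B : set R, measurable B ->
    P (A `&` L @^-1` B) = (\int[distribution P L]_(l in B) (g l)%:E)%E.

(* Poisson probability with mean [r] of the value [n]. The library's
   [poisson_pmf] is not used because it is constantly 1 at mean 0. *)
Definition poisson_weight {R : realType} (r : R) (n : nat) : R :=
  expR (- r) * r ^+ n / n`!%:R.

(* Conditionally on [L], the process [X] (used at times >= 0 only) is a Poisson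
   process of rate [L]: it starts at 0, and given L = l its increments over
   successive intervals are independent, Poisson with mean l times the length.
   For m = 1 the second clause is the conditional law of a single increment;
   for general m the product form is conditional independence. *)
Definition is_cond_poisson_process {d : measure_display}
    {T : measurableType d} {R : realType} (P : probability T R)
    (L : {RV P >-> R}) (X : R -> {RV P >-> nat}) : Prop :=
  {ae P, forall w : T, X 0 w = 0%N} /\
  forall (m : nat) (t : nat -> R) (n : nat -> nat),
    0 <= t 0%N -> (forall i : nat, (i < m)%N -> t i < t i.+1) ->
    is_cond_prob L
      [set w | forall i : nat, (i < m)%N -> X (t i.+1) w = (X (t i) w + n i)%N]
      (fun l => \prod_(i < m) poisson_weight (l * (t i.+1 - t i)) (n i)).

(* Main.v *)
Require Import Defs.
From HB Require Import structures.
From mathcomp Require Import all_boot all_order all_algebra.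
From mathcomp Require Import all_classical all_reals all_analysis.
From mathcomp Require Import ring measurable_realfun.

(** The factorial moments carry the whole computation.  For a Poisson variable
    of mean r, the m-th one is r^m ([falling_poisson_series]).  Conditioning on
    L = l, where X(t) is Poisson of mean l t, and integrating over the law of L
    therefore gives E[X(t) (X(t) - 1) ... (X(t) - m + 1)] = t^m E[L^m]
    ([cond_poisson_factorial_moment]).

    The moments of the gamma law of shape s and rate a are E[L^m] =
    s (s + 1) ... (s + m - 1) / a^m ([gamma_moment]).  The case m = 0 says that
    the density has mass one, which holds because it is the density of a
    probability; so the value of the Gamma function never has to be computed.
    The step from m to m + 1 is the functional equation of Euler's integral
    ([gamma_integral_recurrence]).

    With s = 1/k this gives E[X(t)] = t / (k a) and
    E[X(t) (X(t) - 1)] = t^2 (1/k) (1/k + 1) / a^2, and Z(t) = k X(t) + 1 is an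
    affine image of X(t) ([expectation_variance_affine_nat]). *)

Set Implicit Arguments.
Unset Strict Implicit.
Unset Printing Implicit Defensive.

Import Order.TTheory GRing.Theory Num.Theory.
Import numFieldNormedType.Exports.

Local Open Scope classical_set_scope.
Local Open Scope ring_scope.

(** * Integration against a law with a density *)

(** The density f agrees almost everywhere with the Radon-Nikodym derivative of
    nu, for which the change of variables is known: both have the same integrals
    over all measurable sets. *)
Lemma integral_with_density (d : measure_display) (T : measurableType d)
    (R : realType) (nu : {finite_measure set T -> \bar R})
    (mu : {sigma_finite_measure set T -> \bar R}) (f : T -> R) :
  measurable_fun [set: T] f -> (forall x, 0 <= f x) ->
  (forall U, measurable U -> nu U = (\int[mu]_(x in U) (f x)%:E)%E) ->
  forall (g : T -> \bar R) (E : set T),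
    (forall x, (0 <= g x)%E) -> measurable E -> measurable_fun E g ->
  (\int[nu]_(x in E) g x = \int[mu]_(x in E) (g x * (f x)%:E))%E.
Proof.
move=> mf f0 nuE g E g0 mE mg.
have mEf : measurable_fun [set: T] (EFin \o f) by exact/measurable_EFinP.
have numu : nu `<< mu.
  apply/null_content_dominatesP => A mA A0.
  by rewrite nuE// null_set_integral//; exact: measurable_funTS.
rewrite -(Radon_Nikodym_SigmaFinite.change_of_variables numu)//.
have iRN := Radon_Nikodym_SigmaFinite.f_integrable numu.
have mRN := measurable_int _ iRN.
apply: ae_eq_integral => //.
- by apply: emeasurable_funM => //; exact: measurable_funTS.
- by apply: emeasurable_funM => //; exact: measurable_funTS.
apply: ae_eqe_mul2l.
apply: integral_ae_eq => //.
- exact: integrableS iRN.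
- exact: measurable_funTS.
- by move=> A AE mA; rewrite -Radon_Nikodym_SigmaFinite.f_integral// nuE.
Qed.

(** Lebesgue measure lives on the copy [measurableTypeR R] of the line, whose
    display is not that of R.  The law of L is therefore first moved to this copy,
    by pulling the integral back to the sample space. *)
Lemma integral_distribution_density (d : measure_display)
    (T : measurableType d) (R : realType) (P : probability T R)
    (L : {RV P >-> R}) (f : R -> R) :
  measurable_fun [set: R] f -> (forall x, 0 <= f x) ->
  (forall U, measurable U ->
     distribution P L U = (\int[lebesgue_measure]_(x in U) (f x)%:E)%E) ->
  forall (g : R -> \bar R) (E : set R),
    (forall x, (0 <= g x)%E) -> measurable E -> measurable_fun E g ->
  (\int[distribution P L]_(x in E) g x =
   \int[lebesgue_measure]_(x in E) (g x * (f x)%:E))%E.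
Proof.
move=> mf f0 LE g E g0 mE mg.
have mL : measurable_fun [set: T] (L : T -> measurableTypeR R).
  exact: (measurable_funP L).
pose L' : {RV P >-> measurableTypeR R} :=
  @mfun_Sub _ _ T (measurableTypeR R) L (mem_set mL).
rewrite -(@integral_with_density _ _ R (distribution P L') lebesgue_measure)//.
rewrite /distribution !ge0_integral_pushforward//.
Qed.

(** * The functional equation of Euler's integral *)

(** Integration by parts on the half line in a form where all integrands are
    nonnegative, so that both sides make sense even if they are infinite: the
    integrals of f and g over [1/n, n] differ by F(n) - F(1/n), which tends to 0,
    and they increase to the integrals over the half line.  Staying away from 0
    allows f and g to be singular there. *)
Lemma integral0y_eq_of_deriv_sub (R : realType) (F f g : R -> R) :
  (forall x : R, 0 < x -> is_derive x 1 F (f x - g x)) ->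
  {in `]0, +oo[, continuous f} -> {in `]0, +oo[, continuous g} ->
  (forall x : R, 0 < x -> 0 <= f x) -> (forall x : R, 0 < x -> 0 <= g x) ->
  F x @[x --> 0^'+] --> 0 -> F x @[x --> +oo] --> 0 ->
  (\int[lebesgue_measure]_(x in `]0%R, +oo[) (f x)%:E =
   \int[lebesgue_measure]_(x in `]0%R, +oo[) (g x)%:E)%E.
Proof.
move=> dF cf cg f0 g0 F0 Fy.
pose I (n : nat) : set R := `[n.+2%:R^-1, n.+2%:R]%classic.
have n0 (n : nat) : 0 < n.+2%:R^-1 :> R by rewrite invr_gt0.
have nn (n : nat) : n.+2%:R^-1 < n.+2%:R :> R.
  by rewrite (@lt_trans _ _ 1)// ?invf_lt1// ltr1n.
have I0 n (x : R) : I n x -> 0 < x.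
  by rewrite /I/= in_itv/= => /andP[+ _]; exact: lt_le_trans.
have I0y : \bigcup_n I n = `]0, +oo[%classic.
  apply/seteqP; split => [x [n _ /I0]|x]; first by rewrite /= in_itv/= andbT.
  rewrite /= in_itv/= andbT => x0.
  have m0 : 0 <= x + x^-1 by rewrite addr_ge0 ?invr_ge0 ?ltW.
  have /andP[_ xN] := truncn_itv m0; set N := Num.truncn _ in xN.
  have {}xN : x + x^-1 <= N.+2%:R.
    by apply: (le_trans (ltW xN)); rewrite ler_nat.
  exists N => //; rewrite /I/= in_itv/=; apply/andP; split.
    rewrite -[leRHS]invrK lef_pV2 ?posrE ?invr_gt0//.
    by apply: le_trans xN; rewrite lerDr ltW.
  by apply: le_trans xN; rewrite lerDl ltW ?invr_gt0.
have ndI : nondecreasing_seq I.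
  move=> m n mn; apply/subsetPset => x; rewrite /I/= !in_itv/= => /andP[mx xm].
  rewrite (le_trans _ mx) ?(le_trans xm) ?ler_nat//.
  by rewrite lef_pV2 ?posrE// ler_nat.
have mI n : measurable (I n) by exact: measurable_itv.
have wI (h : R -> R) n :
    {in `]0, +oo[, continuous h} -> {within I n, continuous h}.
  move=> ch; apply: continuous_in_subspaceT => x /[1!inE] /I0 x0.
  by apply: ch; rewrite in_itv/= x0.
have iI (h : R -> R) n : {in `]0, +oo[, continuous h} ->
    lebesgue_measure.-integrable (I n) (EFin \o h).
  move=> ch; apply: continuous_compact_integrable; first exact: segment_compact.
  exact: wI.
have cvgI (h : R -> R) :
    {in `]0, +oo[, continuous h} -> (forall x : R, 0 < x -> 0 <= h x) ->
    (\int[lebesgue_measure]_(x in I n) (h x)%:E)%E @[n --> \oo] -->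
    (\int[lebesgue_measure]_(x in `]0%R, +oo[) (h x)%:E)%E.
  move=> ch h0; rewrite -I0y.
  apply: ge0_nondecreasing_set_cvg_integral => //.
  - by move=> n; exact: (measurable_int _ (iI _ n ch)).
  - by move=> n x /I0 x0; rewrite lee_fin h0.
have FTC n : (\int[lebesgue_measure]_(x in I n) (f x)%:E =
    \int[lebesgue_measure]_(x in I n) (g x)%:E +
    (F n.+2%:R - F n.+2%:R^-1)%:E)%E.
  have := @continuous_FTC2 R (f \- g) F n.+2%:R^-1 n.+2%:R (nn n).
  have cF (x : R) : 0 < x -> F y @[y --> x] --> F x.
    move=> x0; have [dx _] := dF _ x0.
    exact/differentiable_continuous/derivable1_diffP.
  move=> H; rewrite EFinB -H.
  - rewrite integralB_EFin ?iI//= addeC subeK//.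
    by rewrite integrable_fin_num// iI.
  - by apply: wI => x x0; apply: cvgB; [exact: cf|exact: cg].
  - split.
    + move=> x; rewrite in_itv/= => /andP[/(lt_trans (n0 n)) x0 _].
      by have [] := dF _ x0.
    + exact/cvg_at_right_filter/cF.
    + exact/cvg_at_left_filter/cF.
  - move=> x; rewrite in_itv/= => /andP[/(lt_trans (n0 n)) x0 _].
    by rewrite derive1E; have [_ ->] := dF _ x0.
have Fn0 : (F n.+2%:R - F n.+2%:R^-1)%:E @[n --> \oo] --> 0%E.
  apply: cvg_EFin; first by near=> n.
  rewrite -[X in _ --> X](subr0 0); apply: cvgB.
  + move/cvg_pinftyP : Fy; apply.
    under eq_fun do rewrite -addn2.
    exact: (cvg_comp _ _ (cvg_addnr 2) (@cvgr_idn R)).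
  + move/cvg_at_rightP : F0; apply; split => //.
    by have := @cvg_harmonic R; rewrite -cvg_shiftS.
have := cvgI f cf f0.
under eq_fun do rewrite FTC.
move=> /cvg_lim <-//; apply/cvg_lim => //; rewrite -[X in _ --> X]adde0.
by apply: cvgeD => //; [rewrite fin_num_adde_defl|exact: cvgI].
Unshelve. all: by end_near. Qed.

Lemma powR_expRN_cvgy (R : realType) (a s : R) : 0 < a -> 0 < s ->
  x `^ s * expR (- (a * x)) @[x --> +oo] --> 0.
Proof.
move=> a0 s0; pose C : R := (2 * s / a) `^ s.
have bound : \forall x \near +oo,
    0 <= x `^ s * expR (- (a * x)) <= C * expR (- (a / 2 * x)).
  near=> x; have x0 : 0 < x by near: x; exact: nbhs_pinfty_gt.
  rewrite mulr_ge0 ?powR_ge0 ?expR_ge0//=.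
  have -> : - (a * x) = - (a / 2 * x) - a / 2 * x by field.
  rewrite expRD mulrA [leLHS]mulrAC ler_wpM2r ?expR_ge0//.
  rewrite expRN ler_pdivrMr ?expR_gt0//.
  (* y <= expR y, raised to the power s, bounds the power by half of the
     exponential decay. *)
  set y := a * x / (2 * s).
  have y0 : 0 < y by rewrite /y divr_gt0 ?mulr_gt0.
  have xE : x = 2 * s / a * y by rewrite /y; field; rewrite !gt_eqF.
  have c0 : 0 < 2 * s / a by rewrite divr_gt0 ?mulr_gt0.
  rewrite [in X in X `^ s]xE powRM ?(ltW c0) ?(ltW y0)// -/C.
  apply: ler_wpM2l; first exact: powR_ge0.
  have -> : a / 2 * x = y * s by rewrite /y; field; rewrite !gt_eqF.
  rewrite expRM ge0_ler_powR ?nnegrE ?expR_ge0 ?ltW//.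
  by apply: lt_le_trans (expR_ge1Dx y); rewrite ltrDr.
apply: (squeeze_cvgr bound); first exact: cvg_cst.
rewrite -(mulr0 C); apply: cvgMr.
apply: (@cvg_comp _ _ _ (fun x => a / 2 * x) (fun z => expR (- z)) _
  (pinfty_nbhs R)); last exact: cvgr_expR.
by apply: gt0_cvgMry; rewrite ?divr_gt0.
Unshelve. all: by end_near. Qed.

(** Gamma(s + 1) = s Gamma(s), in scaled form: x^s e^(-ax) vanishes at both ends
    of the half line. *)
Lemma gamma_integral_recurrence (R : realType) (a s : R) : 0 < a -> 0 < s ->
  (a%:E * \int[lebesgue_measure]_(x in `]0%R, +oo[)
            (x `^ s * expR (- (a * x)))%:E =
   s%:E * \int[lebesgue_measure]_(x in `]0%R, +oo[)
            (x `^ (s - 1) * expR (- (a * x)))%:E)%E.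
Proof.
move=> a0 s0.
have dexp (x : R) : is_derive x 1 (fun x : R => expR (- (a * x)))
    (- a * expR (- (a * x))).
  by apply: is_derive_eq; rewrite !scaler1 mulrN mulNr mulrC.
have dpow (p x : R) : 0 < x ->
    is_derive x 1 (fun x : R => x `^ p) (p * x `^ (p - 1)).
  exact: is_derive1_powR.
have cts (f : R -> R) (x df : R) :
    is_derive x 1 f df -> f y @[y --> x] --> f x.
  by case=> dx _; exact/differentiable_continuous/derivable1_diffP.
have cpow (p c : R) : {in `]0, +oo[,
    continuous (fun x : R => c * (x `^ p * expR (- (a * x))))}.
  move=> x; rewrite in_itv/= andbT => x0.
  apply: cvgMr; apply: cvgM.
    exact: (cts _ _ _ (dpow p _ x0)).
  exact: (cts _ _ _ (dexp x)).
have pow0 (p x : R) : 0 <= x `^ p * expR (- (a * x)).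
  by rewrite mulr_ge0 ?powR_ge0 ?expR_ge0.
have mpow (p : R) : measurable_fun (`]0, +oo[%classic : set R)
    (fun x : R => (x `^ p * expR (- (a * x)))%:E).
  apply/measurable_EFinP/measurable_funTS/measurable_funM.
    exact: measurable_powR.
  by apply: measurableT_comp => //; apply: measurableT_comp.
rewrite -!ge0_integralZl//;
  try by [exact: mpow|rewrite lee_fin ltW|move=> x _; rewrite lee_fin].
apply/esym.
(* The antiderivative of s x^(s-1) e^(-ax) - a x^s e^(-ax). *)
apply: (@integral0y_eq_of_deriv_sub R (fun x => x `^ s * expR (- (a * x)))
  (fun x => s * (x `^ (s - 1) * expR (- (a * x))))
  (fun x => a * (x `^ s * expR (- (a * x))))) => //.
- move=> x x0; have dp := dpow s x x0; have de := dexp x.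
  by apply: is_derive_eq; rewrite /GRing.scale/=; ring.
- by move=> x x0; exact: mulr_ge0 (ltW s0) (pow0 _ _).
- by move=> x x0; exact: mulr_ge0 (ltW a0) (pow0 _ _).
- have := cvgM (powR_cvg0 s0) (cvg_at_right_filter (cts _ _ _ (dexp 0))).
  by rewrite mul0r; exact.
- exact: powR_expRN_cvgy.
Qed.

(** * Moments of the gamma law *)

Lemma Gamma_fun_ge0 (R : realType) (s : R) : 0 <= Gamma_fun s.
Proof.
by apply: Rintegral_ge0 => x _; rewrite mulr_ge0 ?powR_ge0 ?expR_ge0.
Qed.

Lemma gamma_pdf_ge0 (R : realType) (s a x : R) : 0 <= gamma_pdf s a x.
Proof.
rewrite /gamma_pdf; case: ifP => // _.
by rewrite !mulr_ge0 ?invr_ge0 ?powR_ge0 ?expR_ge0 ?Gamma_fun_ge0.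
Qed.

Lemma measurable_gamma_pdf (R : realType) (s a : R) :
  measurable_fun [set: R] (gamma_pdf s a).
Proof.
apply: measurable_fun_if => //.
  exact: measurable_fun_ltr.
apply: measurable_funTS; apply: measurable_funM; last exact: measurable_powR.
apply: measurable_funM => //.
by apply: measurableT_comp => //; apply: measurableT_comp.
Qed.

Lemma gamma_distribution_gt0 (d : measure_display) (T : measurableType d)
    (R : realType) (P : probability T R) (L : {RV P >-> R}) (s a : R) :
  has_gamma_distribution L s a -> distribution P L `]0, +oo[ = 1%E.
Proof.
move=> gL; have := gL setT measurableT.
rewrite (probability_setT (distribution P L)) gL// => ->.
rewrite [RHS](integral_mkcond) [LHS]integral_mkcond; apply: eq_integral => x _.
rewrite !patchE in_setT; case: ifPn => //; rewrite notin_setE /= in_itv/= andbT.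
by rewrite /gamma_pdf => /negP/negPf ->.
Qed.

(** By induction on m, from the mass of the law and the functional equation.  The
    normalizing constant c of the density is never evaluated: it is absorbed into
    the moment of order m. *)
Lemma gamma_moment (d : measure_display) (T : measurableType d)
    (R : realType) (P : probability T R) (L : {RV P >-> R}) (s a : R) :
  0 < a -> 0 < s -> has_gamma_distribution L s a -> forall m : nat,
  (\int[distribution P L]_(l in `]0%R, +oo[) (l ^+ m)%:E =
   ((\prod_(i < m) (s + i%:R)) / a ^+ m)%:E)%E.
Proof.
move=> a0 s0 gL m.
pose c := a `^ s / Gamma_fun s.
have c0 : 0 <= c by rewrite divr_ge0 ?powR_ge0 ?Gamma_fun_ge0.
pose K j := (\int[lebesgue_measure]_(x in `]0%R, +oo[)
   (x `^ (s + j%:R - 1) * expR (- (a * x)))%:E)%E.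
have momentE j :
    (\int[distribution P L]_(l in `]0%R, +oo[) (l ^+ j)%:E = c%:E * K j)%E.
  (* The change of variables wants an integrand nonnegative on the whole line. *)
  transitivity (\int[distribution P L]_(l in `]0%R, +oo[) (`|l| ^+ j)%:E)%E.
    apply: eq_integral => x; rewrite inE/= in_itv/= andbT => x0.
    by rewrite gtr0_norm.
  rewrite (integral_distribution_density (measurable_gamma_pdf s a)
    (gamma_pdf_ge0 s a) gL)//.
  - rewrite -ge0_integralZl//; last 2 first.
      apply/measurable_EFinP/measurable_funTS/measurable_funM.
        exact: measurable_powR.
      by apply: measurableT_comp => //; apply: measurableT_comp => //.
      by move=> x _; rewrite lee_fin mulr_ge0 ?powR_ge0 ?expR_ge0.
    apply: eq_integral => x; rewrite inE/= in_itv/= andbT => x0.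
    rewrite -!EFinM /gamma_pdf x0 gtr0_norm// -/c; congr EFin.
    have -> : s + j%:R - 1 = (s - 1) + j%:R by ring.
    rewrite [X in _ = _ * (X * _)]powRD; last by apply/implyP => _; rewrite gt_eqF.
    by rewrite powR_mulrn ?(ltW x0)//; ring.
  - apply/measurable_EFinP/measurable_funTS/measurable_funX.
    exact: normr_measurable.
elim: m => [|m IH].
  rewrite big_ord0 divr1.
  under eq_integral do rewrite expr0.
  rewrite integral_cst// mul1e; exact: gamma_distribution_gt0 gL.
rewrite momentE.
have := gamma_integral_recurrence a0 (ltr_wpDr (ler0n R m) s0).
rewrite -/(K m) => rec.
have {rec} -> : (K m.+1 = (a^-1 * (s + m%:R))%:E * K m)%E.
  rewrite EFinM -muleA -rec muleA -EFinM mulVf ?gt_eqF// mul1e.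
  by rewrite /K -natr1; apply: eq_integral => x _; do 3 f_equal; ring.
rewrite muleCA -momentE IH -EFinM big_ord_recr/= exprSr; congr EFin.
by field; rewrite expf_neq0 ?gt_eqF.
Qed.

(** * Factorial moments of the mixed Poisson process *)

Lemma poisson_weight_ge0 (R : realType) (r : R) (n : nat) :
  0 <= r -> 0 <= poisson_weight r n.
Proof.
by move=> r0; rewrite /poisson_weight divr_ge0// mulr_ge0 ?expR_ge0 ?exprn_ge0.
Qed.

(** The factor n (n - 1) ... (n - m + 1) cancels the first factors of n!, which
    leaves r^m times the exponential series. *)
Lemma falling_poisson_series (R : realType) (r : R) (m : nat) : 0 <= r ->
  (\sum_(n <oo) ((n ^_ m)%:R * poisson_weight r n)%:E = (r ^+ m)%:E)%E.
Proof.
move=> r0.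
have pw0 n : 0 <= poisson_weight r n by exact: poisson_weight_ge0.
(* The terms of index n < m vanish; the others are shifted down to index 0. *)
rewrite (nneseries_split 0 m); last by move=> n _; rewrite lee_fin mulr_ge0.
rewrite big1_seq ?add0e; last first.
  move=> n; rewrite mem_index_iota => /andP[_ nm].
  by rewrite ffact_small ?mul0r.
rewrite add0n -nneseries_addn; last by move=> n; rewrite lee_fin mulr_ge0.
have E n : ((n + m) ^_ m)%:R * poisson_weight r (n + m) =
    r ^+ m * expR (- r) * exp_coeff r n.
  rewrite /poisson_weight /exp_coeff/=.
  have := ffact_fact (leq_addl n m); rewrite addnK.
  move=> /(congr1 (GRing.natmul (1 : R))); rewrite natrM.
  move=> /(canRL (mulfK _)) ->; last by rewrite pnatr_eq0 -lt0n fact_gt0.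
  have : (n + m)`!%:R != 0 :> R by rewrite pnatr_eq0 -lt0n fact_gt0.
  have : n`!%:R != 0 :> R by rewrite pnatr_eq0 -lt0n fact_gt0.
  by rewrite exprD => ? ?; field; apply/andP.
under eq_eseriesr do rewrite E EFinM.
rewrite nneseriesZl; last by move=> n _; rewrite lee_fin exp_coeff_ge0.
have -> : (\sum_(n <oo) (exp_coeff r n)%:E)%E = (expR r)%:E.
  rewrite /expR -EFin_lim; last exact: is_cvg_series_exp_coeff.
  by apply/congr_lim/funext => n; rewrite /= -sumEFin.
by rewrite -EFinM -mulrA -expRD addNr expR0 mulr1.
Qed.

Lemma measure_ae_eq_set (d : measure_display) (T : measurableType d)
    (R : realType) (mu : {measure set T -> \bar R}) (A B : set T) :
  measurable A -> measurable B ->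
  {ae mu, forall w, A w <-> B w} -> mu A = mu B.
Proof.
move=> mA mB [N [mN N0 subN]].
rewrite -(measureU0 mA mN N0) -(measureU0 mB mN N0); congr (mu _).
have AB w : ~ N w -> A w <-> B w by move=> Nw; apply: contrapT => /subN.
by apply/seteqP; split => w /=; have [Nw|/AB ABw] := pselect (N w); tauto.
Qed.

Lemma measurable_eq_nat (d : measure_display) (T : measurableType d)
    (f g : T -> nat) : measurable_fun [set: T] f -> measurable_fun [set: T] g ->
  measurable [set w | f w = g w].
Proof.
move=> mf mg.
have -> : [set w | f w = g w] =
    \bigcup_j (f @^-1` [set j] `&` g @^-1` [set j]).
  apply/seteqP; split => [w /= fg|w [j _ [/= -> ->]]//].
  by exists (f w).
apply: bigcup_measurable => j _.
apply: measurableI; rewrite -[X in measurable X]setTI.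
  exact: mf.
exact: mg.
Qed.

(** X(t) is almost surely the increment of the process over the interval from 0
    to t.  For t = 0 there is no such interval, and X(0) = 0 matches the Poisson
    weights of mean 0 directly. *)
Lemma cond_poisson_marginal (d : measure_display) (T : measurableType d)
    (R : realType) (P : probability T R) (L : {RV P >-> R})
    (X : R -> {RV P >-> nat}) (t : R) (B : set R) (n : nat) :
  is_cond_poisson_process L X -> 0 <= t -> measurable B ->
  (P ([set w | X t w = n] `&` L @^-1` B) =
   \int[distribution P L]_(l in B) (poisson_weight (l * t) n)%:E)%E.
Proof.
move=> [X0 incr] t0 mB.
have mXt (u : R) : measurable_fun [set: T] (X u) by exact: measurable_funP.
have mLB : measurable (L @^-1` B).
  by rewrite -[X in measurable X]setTI; exact: (measurable_funP L).
have mXn (u : R) j : measurable [set w | X u w = j] by exact: measurable_eq_nat.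
move: t0; rewrite le_eqVlt => /predU1P[<-|t0].
  have E (l : R) : poisson_weight (l * 0) n = (n == 0%N)%:R.
    rewrite mulr0 /poisson_weight oppr0 expR0 mul1r expr0n.
    by case: n => [|n]/=; rewrite ?divr1 ?mul0r.
  under eq_integral do rewrite E.
  rewrite integral_cst//; case: n {E} => [|n]/=.
    rewrite mul1e /distribution/= /pushforward; apply: measure_ae_eq_set => //.
      exact: measurableI.
    by apply: filterS X0 => w Xw; split => [[]|].
  rewrite mul0e -(measure0 P); apply: measure_ae_eq_set => //.
    exact: measurableI.
  by apply: filterS X0 => w Xw; split => // -[/=]; rewrite Xw.
(* One increment, over the interval from 0 to t. *)
have incr1 i : (i < 1)%N -> i%:R * t < i.+1%:R * t.
  by move=> _; rewrite ltr_pM2r// ltr_nat.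
have := (incr 1%N (fun i => i%:R * t) (fun=> n) _ incr1).2 _ mB.
rewrite mul0r => /(_ (lexx 0)).
under eq_integral do rewrite big_ord1 /= mul1r mul0r subr0.
move=> <-; apply: measure_ae_eq_set => //.
- exact: measurableI.
- apply: measurableI => //.
  have -> : [set w | forall i, (i < 1)%N ->
      X (i.+1%:R * t) w = (X (i%:R * t)%R w + n)%N] =
      [set w | X t w = (X 0%R w + n)%N].
    apply/seteqP; split => w /=; first by move=> /(_ 0%N isT); rewrite mul1r mul0r.
    by move=> H [|//] _; rewrite mul1r mul0r.
  apply: measurable_eq_nat => //.
  by apply: (@measurableT_comp _ _ _ _ _ _ (addn^~ n)).
- apply: filterS X0 => w Xw; split => -[/= H Bw]; split => //=.
    by move=> [|//] _; rewrite mul1r mul0r Xw H.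
  by have := H 0%N isT; rewrite mul1r mul0r Xw.
Qed.

(** The expectation is a sum over the values n of X(t).  Each term is an integral
    over the law of L, and the sum is taken under the integral sign. *)
Lemma cond_poisson_factorial_moment (d : measure_display)
    (T : measurableType d) (R : realType) (P : probability T R)
    (L : {RV P >-> R}) (X : R -> {RV P >-> nat}) (t : R) (m : nat) :
  is_cond_poisson_process L X -> distribution P L `]0, +oo[ = 1%E -> 0 <= t ->
  (\int[P]_w (((X t w) ^_ m)%:R)%:E =
   (t ^+ m)%:E * \int[distribution P L]_(l in `]0%R, +oo[) (l ^+ m)%:E)%E.
Proof.
move=> pX L0 t0.
pose D : set T := L @^-1` `]0, +oo[.
have mL : measurable_fun [set: T] L by exact: measurable_funP.
have mXt : measurable_fun [set: T] (X t) by exact: measurable_funP.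
have mD : measurable D by rewrite -[X in measurable X]setTI; exact: mL.
have mh : measurable_fun [set: T] (fun w => (((X t w) ^_ m)%:R : R)%:E).
  apply/measurable_EFinP.
  have mf : measurable_fun [set: nat] (fun n => (n ^_ m)%:R : R) by [].
  exact: measurableT_comp mf mXt.
(* Outside the null event L <= 0 the weights are nonnegative, as the exchange of
   sum and integral below requires. *)
rewrite (@ge0_negligible_integral _ _ _ _ _ (~` D))//; last 2 first.
- exact: measurableC.
- by have := probability_setC P mD; rewrite (L0 : P D = 1%E) subee.
rewrite setDE setTI setCK.
pose F n := [set w | X t w = n] `&` D.
have mF n : measurable (F n).
  by apply: measurableI => //; exact: measurable_eq_nat.
have DF : D = \bigcup_n F n.
  by apply/seteqP; split => [w Dw|w [n _ []]//]; exists (X t w).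
rewrite DF ge0_integral_bigcup//; last 2 first.
- exact: measurable_funTS.
- by move=> i j _ _ [w [[/= <- _] [/= <- _]]].
pose p (l : R) n := ((n ^_ m)%:R * poisson_weight (l * t) n)%:E.
have p0 n (l : R) : `]0, +oo[%classic l -> (0 <= p l n)%E.
  rewrite /= in_itv/= andbT => l0.
  by rewrite lee_fin mulr_ge0// poisson_weight_ge0// mulr_ge0// ltW.
have mpw n : measurable_fun [set: R] (fun l : R => poisson_weight (l * t) n).
  apply: measurable_funM => //; apply: measurable_funM.
    apply: measurableT_comp => //; apply: measurableT_comp => //.
    exact: measurable_funM.
  by apply: measurable_funX; exact: measurable_funM.
transitivity (\sum_(n <oo) \int[distribution P L]_(l in `]0%R, +oo[) p l n)%E.
  apply: eq_eseriesr => n _.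
  transitivity (\int[P]_(x in F n) ((n ^_ m)%:R)%:E)%E.
    by apply: eq_integral => w /[!inE] -[/= ->].
  transitivity (((n ^_ m)%:R)%:E * P (F n))%E; first exact: integral_cst.
  rewrite (cond_poisson_marginal n pX t0)//.
  rewrite -ge0_integralZl//; last 2 first.
  - exact/measurable_EFinP/measurable_funTS.
  - move=> l; rewrite /= in_itv/= andbT => l0.
    by rewrite lee_fin poisson_weight_ge0// mulr_ge0// ltW.
rewrite -integral_nneseries//; last first.
  by move=> n; apply/measurable_EFinP/measurable_funTS/measurable_funM.
rewrite -ge0_integralZl//; last 3 first.
- exact/measurable_EFinP/measurable_funTS/measurable_funX.
- by move=> l; rewrite /= in_itv/= andbT => l0; rewrite lee_fin exprn_ge0// ltW.
- by rewrite lee_fin exprn_ge0.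
apply: eq_integral => l; rewrite inE/= in_itv/= andbT => l0.
by rewrite falling_poisson_series ?mulr_ge0 ?(ltW l0)// exprMn mulrC EFinM.
Qed.

(** * From factorial moments to expectation and variance *)

(** Finiteness of the two moments makes each term integrable, so that linearity
    holds for coefficients of any sign. *)
Lemma integral_falling_quadratic (d : measure_display) (T : measurableType d)
    (R : realType) (P : probability T R) (N : {RV P >-> nat})
    (e1 e2 : R) :
  (\int[P]_w (((N w) ^_ 1)%:R)%:E = e1%:E)%E ->
  (\int[P]_w (((N w) ^_ 2)%:R)%:E = e2%:E)%E ->
  forall p q r : R,
  (\int[P]_w (p * ((N w) ^_ 2)%:R + q * ((N w) ^_ 1)%:R + r)%:E =
   (p * e2 + q * e1 + r)%:E)%E.
Proof.
move=> E1 E2 p q r.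
have iN m e : (\int[P]_w (((N w) ^_ m)%:R)%:E = e%:E)%E ->
    P.-integrable [set: T] (EFin \o (fun w => ((N w) ^_ m)%:R : R)).
  move=> Ee; apply/integrableP; split.
    apply/measurable_EFinP.
    have mf : measurable_fun [set: nat] (fun n => (n ^_ m)%:R : R) by [].
    apply: measurableT_comp mf _; exact: measurable_funP.
  under eq_integral do rewrite /= ger0_norm//.
  by rewrite Ee ltry.
have iZ m e c : (\int[P]_w (((N w) ^_ m)%:R)%:E = e%:E)%E ->
    P.-integrable [set: T] (fun w => (c * ((N w) ^_ m)%:R)%:E).
  move=> Ee; under eq_fun do rewrite EFinM.
  by apply: integrableZl => //; exact: iN Ee.
have ir : P.-integrable [set: T] (fun=> r%:E).
  exact: finite_measure_integrable_cst.
have EZ m e c : (\int[P]_w (((N w) ^_ m)%:R)%:E = e%:E)%E ->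
    (\int[P]_w (c * ((N w) ^_ m)%:R)%:E = (c * e)%:E)%E.
  move=> Ee; under eq_integral do rewrite EFinM.
  by rewrite integralZl//; [rewrite Ee|exact: iN Ee].
under eq_integral do rewrite !EFinD.
rewrite integralD//; last first.
  by apply: integrableD => //; [exact: iZ E2|exact: iZ E1].
rewrite integralD//; [|exact: iZ E2|exact: iZ E1].
rewrite (EZ _ _ _ E1) (EZ _ _ _ E2) integral_cst//=.
by have -> : P setT = 1%E := probability_setT P; rewrite mule1 !EFinD.
Qed.

Lemma expectation_variance_affine_nat (d : measure_display)
    (T : measurableType d) (R : realType) (P : probability T R)
    (N : {RV P >-> nat}) (e1 e2 : R) :
  (\int[P]_w (((N w) ^_ 1)%:R)%:E = e1%:E)%E ->
  (\int[P]_w (((N w) ^_ 2)%:R)%:E = e2%:E)%E ->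
  forall (b c : R) (Y : T -> R), (forall w, Y w = b * (N w)%:R + c) ->
  ('E_P[Y] = (b * e1 + c)%:E)%E /\
  ('V_P[Y] = (b ^+ 2 * (e2 + e1 - e1 ^+ 2))%:E)%E.
Proof.
move=> E1 E2 b c Y YE.
have Q := integral_falling_quadratic E1 E2.
have EY : ('E_P[Y] = (b * e1 + c)%:E)%E.
  transitivity (0 * e2 + b * e1 + c)%:E; last by congr EFin; ring.
  rewrite -Q unlock.
  by apply: eq_integral => w _; rewrite YE ffactn1; congr EFin; ring.
split=> //.
rewrite /variance unlock EY unlock.
(* (b (N - e1))^2, expanded in falling powers through N^2 = N (N - 1) + N. *)
transitivity
  (b ^+ 2 * e2 + (b ^+ 2 - 2 * b ^+ 2 * e1) * e1 + b ^+ 2 * e1 ^+ 2)%:E.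
  rewrite -Q; apply: eq_integral => w _; congr EFin.
  have -> : ((N w) ^_ 2)%:R = (N w)%:R * ((N w)%:R - 1) :> R.
    rewrite ffactnS ffactn1 natrM; case: (N w) => [|n]; first by rewrite !mul0r.
    by rewrite -natr1 addrK.
  rewrite -[LHS]/((Y w - (b * e1 + c)) * (Y w - (b * e1 + c))) YE ffactn1.
  by ring.
by congr EFin; ring.
Qed.

(** * Mean and variance of the process *)

Unset Implicit Arguments.

Theorem mainTheorem6 (R : realType) (d : measure_display)
    (T : measurableType d) (P : probability T R)
    (k : nat) (a : R) (L : {RV P >-> R}) (X : R -> {RV P >-> nat})
    (Z : R -> T -> R) :
  (1 <= k)%N -> 0 < a ->
  has_gamma_distribution L k%:R^-1 a ->
  is_cond_poisson_process L X ->
  (forall (t : R) (w : T), 0 <= t -> Z t w = k%:R * (X t w)%:R + 1) ->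
  forall t : R, 0 <= t ->
    ('E_P[Z t] = ((a + t) / a)%:E)%E /\
    ('V_P[Z t] = ((a + t) * t * k%:R / a ^+ 2)%:E)%E.
Proof.
move=> k1 a0 gL pX ZE t t0.
have k0 : 0 < k%:R^-1 :> R by rewrite invr_gt0 ltr0n.
have kn0 : k%:R != 0 :> R by rewrite pnatr_eq0 -lt0n.
have moment m :=
  cond_poisson_factorial_moment m pX (gamma_distribution_gt0 gL) t0.
have E1 := moment 1%N.
have E2 := moment 2%N.
rewrite (gamma_moment a0 k0 gL) -EFinM in E1.
rewrite (gamma_moment a0 k0 gL) -EFinM in E2.
have [-> ->] := expectation_variance_affine_nat E1 E2 (fun w => ZE t w t0).
rewrite !big_ord_recl !big_ord0 /= /bump leq0n addn0.
have an0 : a != 0 by rewrite gt_eqF.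
rewrite (_ : (1%N)%:R = 1 :> R)//.
by split; congr EFin; field; rewrite an0.
Qed.
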